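(* Let $\alpha_0,\alpha_1,\alpha_2$ be complex parameters with $\alpha_0+\alpha_1+\alpha_2=\frac12$, and consider the system $$\frac{dx}{dt}=\frac{2x^2y}{t}-x^2-\frac{2\alpha_0x}{t}+\frac1t,\qquad \frac{dy}{dt}=-\frac{2xy^2}{t}+2xy+\frac{2\alpha_0y}{t}+\alpha_1.$$ This system admits extended affine Weyl group symmetry of type $D_3^{(2)}$ as a group of Bäcklund transformations, with generators acting on $(x,y,t;\alpha_0,\alpha_1,\alpha_2)$ by \begin{align*} s_0:&\ \to \left(-x,\,-y+\tfrac{2\alpha_0}{x}-\tfrac{1}{x^2},\,-t;\,-\alpha_0,\alpha_1+2\alpha_0,\alpha_2\right),\\ s_1:&\ \to \left(x+\tfrac{\alpha_1}{y},\,y,\,t;\,\alpha_0+\alpha_1,-\alpha_1,\alpha_2+\alpha_1\right),\\ s_2:&\ \to (x,\,y-t,\,-t;\,\alpha_0,\alpha_1+2\alpha_2,-\alpha_2),\\ \pi:&\ \to \left(\tfrac{1}{tx},\,-tx(yx+\alpha_1),\,t;\,\alpha_2,\alpha_1,\alpha_0\right). \end{align*} That is: each of $s_0,s_1,s_2,\pi$ is a Bäcklund transformation of the system; the group generated by $s_0,s_1,s_2$ is the affine Weyl group of type $D_3^{(2)}$ with these as simple reflections (defining relations $s_i^2=1$, $(s_0s_2)^2=1$, $(s_0s_1)^4=(s_1s_2)^4=1$); and $\pi$ realizes the diagram automorphism: $\pi^2=1$, $\pi s_0=s_2\pi$, $\pi s_1=s_1\pi$.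
   Context: A transformation $(x,y,t;\alpha)\mapsto(x',y',t';\alpha')$, with $x',y',t'$ rational in $x,y,t,\alpha$, is a Bäcklund transformation of the system if, whenever $(x(t),y(t))$ solves the system with parameters $\alpha$, the pair $(x',y')$, viewed as a function of the independent variable $t'$ (where defined), solves the same system with parameters $\alpha'$. Such transformations are composed as automorphisms of the field of rational functions in $x,y,t$ and the parameters (subject to their linear relation): e.g. $s_1(x)=x+\alpha_1/y$, $s_1(\alpha_0)=\alpha_0+\alpha_1$. *)

(* Defs.v *)
From mathcomp Require Import all_boot all_order all_algebra.
From mathcomp Require Import classical_sets reals topology normedtype derive.
From mathcomp Require Import complex.
(* The notations of mpoly clash with those of MathComp-Analysis. *)
From mathcomp Require Import -(notations) mpoly.

Set Implicit Arguments.
Unset Strict Implicit.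
Unset Printing Implicit Defensive.

Import Order.TTheory GRing.Theory Num.Theory.
Import numFieldNormedType.Exports.

Local Open Scope classical_set_scope.
Local Open Scope ring_scope.

(* The field C(x, y, t, alpha0, alpha1, alpha2) modulo the linear relation
   alpha0 + alpha1 + alpha2 = 1/2 is presented as C(x, y, t, alpha0, alpha1),
   the indeterminates being numbered in this order, with alpha2 expressed
   through the relation. *)
Definition ratfun (C : fieldType) : fieldType := {fraction (mpoly 5 C)}.

Section RationalFunctions.
Variable C : fieldType.
Local Notation K := (ratfun C).

Definition embed (p : mpoly 5 C) : K := tofrac p.
Definition const (c : C) : K := embed (mpolyC 5 c).

Definition indet (i : 'I_5) : K := embed (mpolyX C (mnm1 i)).
Definition rx : K := indet (@Ordinal 5 0 isT).
Definition ry : K := indet (@Ordinal 5 1 isT).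
Definition rt : K := indet (@Ordinal 5 2 isT).
Definition ra0 : K := indet (@Ordinal 5 3 isT).
Definition ra1 : K := indet (@Ordinal 5 4 isT).
Definition ra2 : K := 2^-1 - ra0 - ra1.

(* A transformation (x, y, t; alpha) |-> (x', y', t'; alpha') with rational
   components. *)
Record transformation := Transformation {
  im_x : K; im_y : K; im_t : K; im_a0 : K; im_a1 : K; im_a2 : K }.

End RationalFunctions.

Arguments rx {C}.
Arguments ry {C}.
Arguments rt {C}.
Arguments ra0 {C}.
Arguments ra1 {C}.
Arguments ra2 {C}.

Definition valuation (F : nzRingType) (x y t a0 a1 : F) : 'I_5 -> F :=
  fun i => nth 0 [:: x; y; t; a0; a1] i.

Section Automorphisms.
Variable C : fieldType.
Local Notation K := (ratfun C).

(* f(x, y, t, alpha0, alpha1) |-> f(x', y', t', alpha0', alpha1'), computed on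
   the representative fraction of f chosen by the quotient [{fraction _}]. *)
Definition subst (m : transformation C) (f : K) : K :=
  let ev := mmap (@const C)
    (valuation (im_x m) (im_y m) (im_t m) (im_a0 m) (im_a1 m)) in
  ev (frac (repr f)).1 / ev (frac (repr f)).2.

(* [subst m] is an automorphism of K over C, and it acts on the six generators
   as prescribed by [m]; in particular the components of [m] satisfy
   alpha0' + alpha1' + alpha2' = 1/2. *)
Definition is_automorphism (m : transformation C) : Prop :=
  [/\ zmod_morphism (subst m), monoid_morphism (subst m),
      forall c, subst m (const c) = const c & bijective (subst m)] /\
  [/\ subst m rx = im_x m, subst m ry = im_y m & subst m rt = im_t m] /\
  [/\ subst m ra0 = im_a0 m, subst m ra1 = im_a1 m & subst m ra2 = im_a2 m].

(* The rational function f is defined at the point p, with value v. *)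
Definition has_value (f : K) (p : 'I_5 -> C) (v : C) : Prop :=
  exists n d : mpoly 5 C,
    [/\ f = embed n / embed d, meval p d != 0 & v = meval p n / meval p d].

Definition s0 : transformation C := Transformation
  (- rx) (- ry + 2 * ra0 / rx - 1 / rx ^+ 2) (- rt)
  (- ra0) (ra1 + 2 * ra0) ra2.

Definition s1 : transformation C := Transformation
  (rx + ra1 / ry) ry rt
  (ra0 + ra1) (- ra1) (ra2 + ra1).

Definition s2 : transformation C := Transformation
  rx (ry - rt) (- rt)
  ra0 (ra1 + 2 * ra2) (- ra2).

Definition s_pi : transformation C := Transformation
  (1 / (rt * rx)) (- rt * rx * (ry * rx + ra1)) rt
  ra2 ra1 ra0.

End Automorphisms.

Section System.
Variable C : numClosedFieldType.

(* (x, y) is a (complex differentiable) solution on the open set U, which must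
   avoid the fixed singularity t = 0 of the system. *)
Definition is_solution (a0 a1 a2 : C) (U : set C) (x y : C -> C) : Prop :=
  [/\ a0 + a1 + a2 = 2^-1, open U &
      forall t, U t ->
        [/\ t != 0,
            is_derive t 1 x
              (2 * x t ^+ 2 * y t / t - x t ^+ 2 - 2 * a0 * x t / t + 1 / t) &
            is_derive t 1 y
              (- (2 * x t * y t ^+ 2 / t) + 2 * x t * y t
               + 2 * a0 * y t / t + a1)]].

(* The functions xi and eta are x' and y' expressed in the variable t':
   tau is a holomorphic local inverse of t |-> t', defined on the open set V of
   values of t', so that at s in V all components are taken at t = tau s. *)
Definition is_backlund (m : transformation C) : Prop :=
  forall (a0 a1 a2 : C) (U : set C) (x y : C -> C),
    is_solution a0 a1 a2 U x y ->
  forall (b0 b1 b2 : C) (V : set C) (tau xi eta : C -> C),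
    V !=set0 -> open V ->
    (forall s, V s -> derivable tau s 1) ->
    (forall s, V s -> U (tau s)) ->
    (forall s, V s ->
       let p := valuation (x (tau s)) (y (tau s)) (tau s) a0 a1 in
       [/\ has_value (im_x m) p (xi s), has_value (im_y m) p (eta s) &
           has_value (im_t m) p s] /\
       [/\ has_value (im_a0 m) p b0, has_value (im_a1 m) p b1 &
           has_value (im_a2 m) p b2]) ->
    is_solution b0 b1 b2 V xi eta.

End System.

(* The affine Weyl group of type D_3^(2), by generators and relations. As the
   squares of the generators are relators, every element is represented by a
   word without inverse letters. *)
Inductive node := n0 | n1 | n2.

Inductive relator : seq node -> Prop :=
| relator_sq i : relator [:: i; i]
| relator_02 : relator [:: n0; n2; n0; n2]
| relator_01 : relator [:: n0; n1; n0; n1; n0; n1; n0; n1]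
| relator_12 : relator [:: n1; n2; n1; n2; n1; n2; n1; n2].

Inductive weyl_eq : seq node -> seq node -> Prop :=
| weyl_refl w : weyl_eq w w
| weyl_sym w1 w2 : weyl_eq w1 w2 -> weyl_eq w2 w1
| weyl_trans w1 w2 w3 : weyl_eq w1 w2 -> weyl_eq w2 w3 -> weyl_eq w1 w3
| weyl_rel u r v : relator r -> weyl_eq (u ++ r ++ v) (u ++ v).

Definition simple_refl (C : fieldType) (i : node) : transformation C :=
  match i with n0 => s0 C | n1 => s1 C | n2 => s2 C end.

(* The word i_1 ... i_k denotes the composite s_(i_1) \o ... \o s_(i_k) of
   automorphisms. *)
Definition word_act (C : fieldType) (w : seq node) : ratfun C -> ratfun C :=
  foldr (fun i f => subst (simple_refl C i) \o f) id w.

Arguments word_act : clear implicits.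

(* Main.v *)
(* A rational function may take a value at a point with coordinates in any
   extension of C, in particular in the field K of rational functions itself.
   For each of the four transformations m, the components of m take at the
   point m of K^5 the values x, y, t, alpha0, alpha1, because m is formally an
   involution. Hence, for a polynomial p, the function obtained by substituting
   m in p takes at m the value p; so the substitution is injective on
   polynomials, extends to K, and is an involutive automorphism. The relations
   can then be checked on x, y, t, alpha0, alpha1; the one between s0 and s1 is
   the conjugate by pi of the one between s1 and s2.

   In the coordinates eps1 = alpha1 + alpha2 and eps2 = alpha2, s1 exchanges
   eps1 and eps2, s0 is eps1 |-> 1 - eps1 and s2 is eps2 |-> - eps2. So the
   infinite dihedral group generated by s0 and s1 s2 s1 acts on eps1, while its
   conjugate by s1, generated by s1 s0 s1 and s2, acts on eps2 and commutes with
   it. The defining relations suffice to bring each word to the form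
   (element of the first group) (element of the second group) s1^e, and its
   three parts can be read off from the images of eps1 and eps2.

   For the Baecklund property, the existence of values at a point excludes the
   zeros of x (for s0 and pi) and of y (for s1); the rest is differentiation. *)
Require Import Defs.
From HB Require Import structures.
From Corelib Require Setoid.
From mathcomp Require Import all_boot all_order all_algebra.
From mathcomp Require Import generic_quotient.
From mathcomp Require Import classical_sets reals topology normedtype derive.
From mathcomp Require Import complex ring.
From mathcomp Require Import -(notations) mpoly.

Set Implicit Arguments.
Unset Strict Implicit.
Unset Printing Implicit Defensive.

Import Order.TTheory GRing.Theory Num.Theory.
Import numFieldNormedType.Exports.

Local Open Scope ring_scope.

Arguments ratfun : simpl never.

(** * Substitution in rational functions *)

Section RationalFunctions.
Variable C : fieldType.
Local Notation K := (ratfun C).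

HB.instance Definition _ := GRing.RMorphism.copy (@embed C) (@FracField.tofrac (mpoly 5 C)).
HB.instance Definition _ := GRing.RMorphism.copy (@const C) (@embed C \o @mpolyC 5 C).

Lemma embed_eq0 (p : mpoly 5 C) : (embed p == 0) = (p == 0).
Proof. exact: tofrac_eq0. Qed.

Lemma embed_inj : injective (@embed C).
Proof. by move=> p q /eqP; rewrite /embed tofrac_eq => /eqP. Qed.

Lemma repr_frac (f : K) :
  f = embed (frac (repr f)).1 / embed (frac (repr f)).2.
Proof.
have d0 := denom_ratioP (repr f).
apply: (canRL (mulfK _)); first by rewrite embed_eq0.
rewrite -{1}[f]reprK /embed; move: (repr f) d0 => r d0.
(* A product in the quotient is the class of the product of representatives, so the claim becomes an
   equivalence of ratios. *)
rewrite -[LHS]/(FracField.mul _ _) !piE.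
apply/eqmodP; rewrite /= FracField.equivfE /FracField.mulf.
by rewrite !numden_Ratio ?mulf_neq0 ?oner_neq0 // !mulr1 mulrC.
Qed.

(** The indeterminates form the generic point of $K^5$, where evaluation loses nothing;
    [images_free] recovers [p] from a value in this way. *)
Lemma mmap_const (p : mpoly 5 C) : mmap (@const C) (@indet C) p = embed p.
Proof.
rewrite [in RHS](mpolyE p) rmorph_sum /=; apply: eq_bigr => m _.
rewrite -mul_mpolyC rmorphM /=; congr (_ * _).
by rewrite mpolyXE_id rmorph_prod; apply: eq_bigr => i _; rewrite rmorphXn.
Qed.

(* [has_value] is the case where [iota] is the identity of C; the points of K^5
   are obtained with [iota := const]. *)
Section Value.
Variables (F : fieldType) (iota : {rmorphism C -> F}) (q : 'I_5 -> F).

Definition value (f : K) (v : F) : Prop :=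
  exists n d : mpoly 5 C,
    [/\ f = embed n / embed d, mmap iota q d != 0 &
        v = mmap iota q n / mmap iota q d].

Lemma mmap_neq0_embed d : mmap iota q d != 0 -> embed d != 0.
Proof. by rewrite embed_eq0; apply: contraNneq => ->; rewrite rmorph0. Qed.

(** Two representations satisfy $n_1 d_2 = n_2 d_1$ already as polynomials, since [embed] is
    injective, and this identity can be evaluated. *)
Lemma value_fun f v1 v2 : value f v1 -> value f v2 -> v1 = v2.
Proof.
move=> [n1 [d1 [e1 p1 ->]]] [n2 [d2 [e2 p2 ->]]].
move/eqP: e2; rewrite e1 eqr_div ?mmap_neq0_embed //.
rewrite -!rmorphM /= => /eqP /embed_inj h.
by apply/eqP; rewrite eqr_div // -!rmorphM /= h.
Qed.

Lemma value_eq f v w : value f v -> v = w -> value f w.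
Proof. by move=> h <-. Qed.

Lemma value_embed p : value (embed p) (mmap iota q p).
Proof.
by exists p, 1; rewrite !rmorph1 !divr1 oner_neq0.
Qed.

Lemma value_const c : value (const c) (iota c).
Proof. by rewrite -[X in value _ X](mmapC q); apply: value_embed. Qed.

Lemma value_indet i : value (indet C i) (q i).
Proof.
apply: value_eq (value_embed _) _.
by rewrite mmapX mmap1U.
Qed.

Lemma valueD f g v w : value f v -> value g w -> value (f + g) (v + w).
Proof.
move=> [n1 [d1 [-> p1 ->]]] [n2 [d2 [-> p2 ->]]].
exists (n1 * d2 + n2 * d1), (d1 * d2).
by rewrite !(rmorphD, rmorphM) /= !addf_div ?mulf_neq0 ?mmap_neq0_embed.
Qed.

Lemma valueN f v : value f v -> value (- f) (- v).
Proof.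
move=> [n1 [d1 [-> p1 ->]]].
by exists (- n1), d1; rewrite !rmorphN !mulNr.
Qed.

Lemma valueM f g v w : value f v -> value g w -> value (f * g) (v * w).
Proof.
move=> [n1 [d1 [-> p1 ->]]] [n2 [d2 [-> p2 ->]]].
exists (n1 * n2), (d1 * d2).
by rewrite !rmorphM /= !mulf_div mulf_neq0.
Qed.

Lemma valueV f v : v != 0 -> value f v -> value f^-1 v^-1.
Proof.
move=> v0 [n1 [d1 [-> p1 ev]]].
exists d1, n1; split; [by rewrite invf_div | | by rewrite ev invf_div].
by apply: contraNneq v0; rewrite ev => ->; rewrite mul0r.
Qed.

Lemma value0 : value 0 0.
Proof. by apply: value_eq (value_embed 0) _; rewrite rmorph0. Qed.

Lemma value1 : value 1 1.
Proof. by apply: value_eq (value_embed 1) _; rewrite rmorph1. Qed.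

Lemma valueX n f v : value f v -> value (f ^+ n) (v ^+ n).
Proof.
move=> h; elim: n => [|n IH]; first exact: value1.
by rewrite !exprS; apply: valueM.
Qed.

Lemma value_nat n : value n%:R n%:R.
Proof.
elim: n => [|n IH]; first exact: value0.
by rewrite !mulrS; apply: valueD => //; apply: value1.
Qed.

Lemma value_mmap (G : 'I_5 -> K) v (p : mpoly 5 C) :
  (forall i, value (G i) (v i)) -> value (mmap (@const C) G p) (mmap iota v p).
Proof.
move=> hG; apply: (big_ind2 value); first exact: value0.
  by move=> *; apply: valueD.
move=> m _; apply: valueM; first exact: value_const.
apply: (big_ind2 value); first exact: value1.
  by move=> *; apply: valueM.
by move=> i _; apply: valueX.
Qed.

End Value.

Definition images (m : transformation C) : 'I_5 -> K :=
  valuation (im_x m) (im_y m) (im_t m) (im_a0 m) (im_a1 m).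

(** That the transformation applied twice is the identity is expressed through values, because
    [subst] is not yet known to be a morphism. *)
Record involution := Involution {
  invol_trans :> transformation C;
  _ : forall i, value (@const C) (images invol_trans) (images invol_trans i) (indet C i) }.

Section Subst.
Variable m : involution.
Local Notation ev := (mmap (@const C) (images m)).

Lemma images_free p : (ev p == 0) = (p == 0).
Proof.
apply/eqP/eqP => [h|->]; last by rewrite rmorph0.
case: m h => m' /= hm h.
have := value_mmap p hm; rewrite h mmap_const => /(value_fun (value0 _ _)) /esym/eqP.
by rewrite embed_eq0 => /eqP.
Qed.

(** The choice made by [repr] disappears here: cross-multiplied fractions remain equal under [ev],
    and [images_free] keeps their denominators nonzero. *)
Lemma subst_frac n d : d != 0 -> subst m (embed n / embed d) = ev n / ev d.
Proof.
move=> d0; rewrite /subst -/(images m).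
have := repr_frac (embed n / embed d).
set r := frac _; have r0 : r.2 != 0 by apply: denom_ratioP.
move/esym/eqP; rewrite eqr_div ?embed_eq0 // -!rmorphM /= => /eqP/embed_inj h.
by apply/eqP; rewrite eqr_div ?images_free // -!rmorphM /= h.
Qed.

Lemma subst_embed p : subst m (embed p) = ev p.
Proof.
by rewrite -[embed p]divr1 -(rmorph1 (@embed C)) subst_frac ?oner_neq0 // rmorph1 divr1.
Qed.

Lemma subst_zmod_morphism : zmod_morphism (subst m).
Proof.
move=> f g; rewrite (repr_frac f) (repr_frac g).
set r := frac (repr f); have r0 : r.2 != 0 by apply: denom_ratioP.
set s := frac (repr g); have s0 : s.2 != 0 by apply: denom_ratioP.
rewrite -mulNr addf_div ?embed_eq0 // -!(rmorphN, rmorphM, rmorphD) /=.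
rewrite !subst_frac ?mulf_neq0 // !(rmorphD, rmorphM, rmorphN) /=.
by rewrite -mulNr addf_div ?images_free.
Qed.

Lemma subst_monoid_morphism : monoid_morphism (subst m).
Proof.
split; first by rewrite -[X in subst m X](rmorph1 (@embed C)) subst_embed rmorph1.
move=> f g; rewrite (repr_frac f) (repr_frac g).
set r := frac (repr f); have r0 : r.2 != 0 by apply: denom_ratioP.
set s := frac (repr g); have s0 : s.2 != 0 by apply: denom_ratioP.
rewrite mulf_div -!rmorphM /= !subst_frac ?mulf_neq0 // !rmorphM /=.
by rewrite mulf_div.
Qed.

HB.instance Definition _ :=
  GRing.isZmodMorphism.Build K K (subst m) subst_zmod_morphism.
HB.instance Definition _ :=
  GRing.isMonoidMorphism.Build K K (subst m) subst_monoid_morphism.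

Lemma subst_const c : subst m (const c) = const c.
Proof. by rewrite subst_embed mmapC. Qed.

Lemma subst_indet i : subst m (indet C i) = images m i.
Proof. by rewrite subst_embed mmapX mmap1U. Qed.

End Subst.

Lemma eq_ratfun_rmorphism (L : fieldType) (u v : {rmorphism K -> L}) :
  (forall c, u (const c) = v (const c)) ->
  (forall i, u (indet C i) = v (indet C i)) -> u =1 v.
Proof.
move=> hc hi.
have he p : u (embed p) = v (embed p).
  rewrite -mmap_const !rmorph_sum; apply: eq_bigr => k _.
  rewrite !rmorphM /= hc !rmorph_prod; congr (_ * _).
  by apply: eq_bigr => i _; rewrite !rmorphXn /= hi.
by move=> f; rewrite (repr_frac f) !fmorph_div !he.
Qed.

End RationalFunctions.

Lemma forall_ord5 (P : 'I_5 -> Prop) :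
  P (@Ordinal 5 0 isT) -> P (@Ordinal 5 1 isT) -> P (@Ordinal 5 2 isT) ->
  P (@Ordinal 5 3 isT) -> P (@Ordinal 5 4 isT) -> forall i, P i.
Proof.
by move=> h0 h1 h2 h3 h4 [[|[|[|[|[|k]]]]] lt_k] //; rewrite (bool_irrelevance lt_k isT).
Qed.

(** * Values of the generators, and the four formal involutions *)

Section Generators.
Variable C : fieldType.
Local Notation K := (ratfun C).

Lemma indet_neq0 i : indet C i != 0.
Proof. by rewrite embed_eq0 -msupp_eq0 msuppX. Qed.

Lemma rx_neq0 : rx != 0 :> K. Proof. exact: indet_neq0. Qed.
Lemma ry_neq0 : ry != 0 :> K. Proof. exact: indet_neq0. Qed.
Lemma rt_neq0 : rt != 0 :> K. Proof. exact: indet_neq0. Qed.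

Section ValueGenerators.
Variables (L : fieldType) (iota : {rmorphism C -> L}) (x y t a0 a1 : L).
Local Notation p := (valuation x y t a0 a1).

Lemma value_rx : value iota p rx x. Proof. exact: value_indet. Qed.
Lemma value_ry : value iota p ry y. Proof. exact: value_indet. Qed.
Lemma value_rt : value iota p rt t. Proof. exact: value_indet. Qed.
Lemma value_ra0 : value iota p ra0 a0. Proof. exact: value_indet. Qed.
Lemma value_ra1 : value iota p ra1 a1. Proof. exact: value_indet. Qed.

Lemma value_ra2 : value iota p ra2 (2^-1 - a0 - a1).
Proof.
(* Treated as a constant, $2^{-1}$ has a value in every characteristic, whereas [valueV] would ask
   for $2 \neq 0$. *)
have half : value iota p 2^-1 2^-1.
  have -> : 2^-1 = const 2^-1 :> K by rewrite fmorphV rmorph_nat.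
  by apply: value_eq (value_const _ _ _) _; rewrite fmorphV rmorph_nat.
apply: valueD (valueN value_ra1); apply: valueD half (valueN value_ra0).
Qed.

End ValueGenerators.
End Generators.

(** Follows the syntax of the function. The value may be an existential variable, which gets filled
    in; the nonvanishing of denominators is left as side goals. *)
Ltac prove_value :=
  lazymatch goal with
  | |- value _ _ (_ + _) _ => apply: valueD; prove_value
  | |- value _ _ (- _) _ => apply: valueN; prove_value
  | |- value _ _ (_ * _) _ => apply: valueM; prove_value
  | |- value _ _ (_ ^-1) _ => apply: valueV; prove_value
  | |- value _ _ (_ ^+ _) _ => apply: valueX; prove_value
  | |- value _ _ 1 _ => apply: value1
  | |- value _ _ 0 _ => apply: value0
  | |- value _ _ (_ %:R) _ => apply: value_nat
  | |- value _ _ rx _ => apply: value_rx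
  | |- value _ _ ry _ => apply: value_ry
  | |- value _ _ rt _ => apply: value_rt
  | |- value _ _ ra0 _ => apply: value_ra0
  | |- value _ _ ra1 _ => apply: value_ra1
  | |- value _ _ ra2 _ => apply: value_ra2
  | _ => idtac
  end.

(* Over the concrete fraction field [ring] and [field] do not terminate in
   practice, so an identity is first generalised to an arbitrary field. *)
Ltac abstract_ratfun C :=
  move: (@rx C) (@ry C) (@rt C) (@ra0 C) (@ra1 C) (@ra2 C);
  move: (ratfun C) => F X Y T A0 A1 A2.

Section Involutions.
Variable C : fieldType.
Local Notation K := (ratfun C).

Lemma involutiveP (m : transformation C) :
  let p := images m in
  value (@const C) p (im_x m) rx -> value (@const C) p (im_y m) ry ->
  value (@const C) p (im_t m) rt -> value (@const C) p (im_a0 m) ra0 ->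
  value (@const C) p (im_a1 m) ra1 ->
  forall i, value (@const C) (images m) (images m i) (indet C i).
Proof. by move=> p hx hy ht h0 h1; apply: forall_ord5. Qed.

Lemma s0_involutive i :
  value (@const C) (images (s0 C)) (images (s0 C) i) (indet C i).
Proof.
have x0 := rx_neq0 C.
move: i; apply: involutiveP; rewrite /images /=; (apply: value_eq; first prove_value).
all: rewrite ?expf_neq0 ?oppr_eq0 ?mulf_neq0 ?opprK //.
- by move: x0; abstract_ratfun C => x0; field; rewrite oppr_eq0 x0.
- by abstract_ratfun C; ring.
Qed.
(** Being canonical, this lets unification find the involution behind [s0 C], so that [subst (s0 C)]
    inherits the ring morphism structure. *)
Canonical s0_inv := Involution s0_involutive.

Lemma s1_involutive i :
  value (@const C) (images (s1 C)) (images (s1 C) i) (indet C i).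
Proof.
have y0 := ry_neq0 C.
move: i; apply: involutiveP; rewrite /images /=; (apply: value_eq; first prove_value).
all: rewrite ?expf_neq0 ?oppr_eq0 ?mulf_neq0 ?opprK //.
- by move: y0; abstract_ratfun C => y0; field.
- by abstract_ratfun C; ring.
Qed.
Canonical s1_inv := Involution s1_involutive.

Lemma s2_involutive i :
  value (@const C) (images (s2 C)) (images (s2 C) i) (indet C i).
Proof.
move: i; apply: involutiveP; rewrite /images /=; (apply: value_eq; first prove_value).
all: rewrite ?opprK //.
- by rewrite subrK.
- by rewrite /ra2; abstract_ratfun C; ring.
Qed.
Canonical s2_inv := Involution s2_involutive.

Lemma s_pi_involutive i :
  value (@const C) (images (s_pi C)) (images (s_pi C) i) (indet C i).
Proof.
have x0 := rx_neq0 C.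
have t0 := rt_neq0 C.
move: i; apply: involutiveP; rewrite /images /=; (apply: value_eq; first prove_value).
1-3: move: x0 t0; abstract_ratfun C => x0 t0.
- by rewrite mul1r mulf_neq0 // invr_eq0 mulf_neq0.
- by rewrite !mul1r; field; rewrite x0 t0 oner_neq0.
- by rewrite !mul1r; field; rewrite x0 t0.
- reflexivity.
- by rewrite /ra2; abstract_ratfun C; ring.
- reflexivity.
Qed.
Canonical s_pi_inv := Involution s_pi_involutive.

End Involutions.

(** * From formal involutions to automorphisms of the field *)

Section Automorphisms.
Variable C : fieldType.
Local Notation K := (ratfun C).

Section Images.
Variable m : involution C.

Lemma subst_rx : subst m rx = im_x m. Proof. exact: subst_indet. Qed.
Lemma subst_ry : subst m ry = im_y m. Proof. exact: subst_indet. Qed.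
Lemma subst_rt : subst m rt = im_t m. Proof. exact: subst_indet. Qed.
Lemma subst_ra0 : subst m ra0 = im_a0 m. Proof. exact: subst_indet. Qed.
Lemma subst_ra1 : subst m ra1 = im_a1 m. Proof. exact: subst_indet. Qed.
Lemma subst_ra2 : subst m ra2 = 2^-1 - im_a0 m - im_a1 m.
Proof.
by rewrite !rmorphB /= subst_ra0 subst_ra1 fmorphV rmorph_nat.
Qed.
End Images.

(** A morphism evaluates a fraction at the images of the generators. Being stated for any morphism,
    this also serves for composites such as $s_1 s_2$. *)
Lemma value_rmorph (L : fieldType) (u : {rmorphism K -> L})
    (iota : {rmorphism C -> L}) x y t a0 a1 f v :
  (forall c, u (const c) = iota c) ->
  u rx = x -> u ry = y -> u rt = t -> u ra0 = a0 -> u ra1 = a1 ->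
  value iota (valuation x y t a0 a1) f v -> u f = v.
Proof.
move=> hc hx hy ht h0 h1 [n [d [-> d0 ->]]].
have he p : u (embed p) = mmap iota (valuation x y t a0 a1) p.
  rewrite -mmap_const rmorph_sum; apply: eq_bigr => k _.
  rewrite rmorphM /= hc rmorph_prod; congr (_ * _).
  apply: eq_bigr => i _; rewrite rmorphXn /=; congr (_ ^+ _).
  by move: i; apply: forall_ord5.
by rewrite fmorph_div /= !he.
Qed.

Lemma eq_on_generators (L : fieldType) (u v : {rmorphism K -> L}) :
  (forall c, u (const c) = v (const c)) ->
  u rx = v rx -> u ry = v ry -> u rt = v rt -> u ra0 = v ra0 -> u ra1 = v ra1 ->
  u =1 v.
Proof. by move=> hc *; apply: eq_ratfun_rmorphism => //; apply: forall_ord5. Qed.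

Lemma value_subst (m : involution C) f v :
  value (@const C) (images m) f v -> subst m f = v.
Proof.
apply: value_rmorph; first exact: subst_const.
- exact: subst_rx.
- exact: subst_ry.
- exact: subst_rt.
- exact: subst_ra0.
- exact: subst_ra1.
Qed.

Lemma eq_subst (m m' : involution C) f g v w :
  value (@const C) (images m) f v -> value (@const C) (images m') g w -> v = w ->
  subst m f = subst m' g.
Proof. by move=> /value_subst -> /value_subst ->. Qed.

Lemma substK (m : involution C) : involutive (subst m).
Proof.
apply: (@eq_ratfun_rmorphism _ _ (subst m \o subst m) idfun) => [c|i] /=.
  by rewrite !subst_const.
rewrite subst_indet; apply: value_subst; case: m => /= m; exact.
Qed.

Lemma involution_is_automorphism (m : involution C) :
  im_a0 m + im_a1 m + im_a2 m = 2^-1 -> is_automorphism m.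
Proof.
move=> sum_a; split; [split|split; split].
- exact: subst_zmod_morphism.
- exact: subst_monoid_morphism.
- exact: subst_const.
- by exists (subst m); apply: substK.
- exact: subst_rx.
- exact: subst_ry.
- exact: subst_rt.
- exact: subst_ra0.
- exact: subst_ra1.
- by rewrite subst_ra2 -sum_a -addrA -opprD addrC addKr.
Qed.

End Automorphisms.

(** * Relations between the generators *)

Section Relations.
Variable C : fieldType.
Local Notation K := (ratfun C).

Lemma eq_subst_comp (m1 m2 m3 m4 : involution C) :
  subst m1 (im_x m2) = subst m3 (im_x m4) ->
  subst m1 (im_y m2) = subst m3 (im_y m4) ->
  subst m1 (im_t m2) = subst m3 (im_t m4) ->
  subst m1 (im_a0 m2) = subst m3 (im_a0 m4) ->
  subst m1 (im_a1 m2) = subst m3 (im_a1 m4) ->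
  subst m1 \o subst m2 =1 subst m3 \o subst m4.
Proof.
move=> ex ey et e0 e1; apply: eq_on_generators => [c|||||] /=.
- by rewrite !subst_const.
- by rewrite !subst_rx.
- by rewrite !subst_ry.
- by rewrite !subst_rt.
- by rewrite !subst_ra0.
- by rewrite !subst_ra1.
Qed.

Lemma s_pi_s0 : subst (s_pi C) \o subst (s0 C) =1 subst (s2 C) \o subst (s_pi C).
Proof.
have x0 := rx_neq0 C; have t0 := rt_neq0 C.
apply: eq_subst_comp;
  (apply: eq_subst; [rewrite /images /=; prove_value..|]).
1-5: move: x0 t0; abstract_ratfun C => x0 t0.
- by rewrite mulf_neq0 // oppr_eq0.
- by field; rewrite ?oppr_eq0 ?oner_neq0 x0 t0.
- by rewrite mul1r invr_eq0 mulf_neq0.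
- by rewrite mul1r expf_neq0 // invr_eq0 mulf_neq0.
- by rewrite !mul1r; field; rewrite ?oppr_eq0 ?oner_neq0 x0 t0.
- reflexivity.
- by rewrite /ra2; abstract_ratfun C; ring.
- reflexivity.
Qed.

Lemma s_pi_s1 : subst (s_pi C) \o subst (s1 C) =1 subst (s1 C) \o subst (s_pi C).
Proof.
have x0 := rx_neq0 C; have y0 := ry_neq0 C; have t0 := rt_neq0 C.
(* This is the image of $x$ under the injective morphism $s_1$. *)
have sx0 : rx + ra1 / ry != 0 :> K.
  by rewrite -[rx + _](subst_rx (s1_inv C)) fmorph_eq0.
have xy0 : ry * rx + ra1 != 0 :> K.
  have -> : ry * rx + ra1 = ry * (rx + ra1 / ry) :> K.
    by move: y0; abstract_ratfun C => y0; field.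
  exact (mulf_neq0 y0 sx0).
apply: eq_subst_comp;
  (apply: eq_subst; [rewrite /images /=; prove_value..|]).
1-4: move: x0 y0 t0 sx0 xy0; abstract_ratfun C => x0 y0 t0 sx0 xy0.
- by rewrite !mulf_neq0 // oppr_eq0.
- exact: mulf_neq0.
- by field; rewrite ?oppr_eq0 [X * Y]mulrC x0 y0 t0 xy0.
- suff: - T * X * (Y * X + A1) = - T * (X + A1 / Y) * (Y * (X + A1 / Y) - A1).
    by [].
  by field.
- reflexivity.
- by rewrite /ra2; abstract_ratfun C; ring.
- reflexivity.
Qed.

Lemma s0_s2 : subst (s0 C) \o subst (s2 C) =1 subst (s2 C) \o subst (s0 C).
Proof.
have x0 := rx_neq0 C.
apply: eq_subst_comp;
  (apply: eq_subst; [rewrite /images /=; prove_value..|]).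
1-4: move: x0; abstract_ratfun C => x0.
- reflexivity.
- exact: x0.
- exact: expf_neq0.
- by field.
- reflexivity.
- reflexivity.
- by rewrite /ra2; abstract_ratfun C; ring.
Qed.

Section CompGenerators.
Variables m1 m2 : involution C.
Local Notation u := (subst m1 \o subst m2).
Local Notation value := (value (@const C) (images m1)).

Lemma comp_rx w : value (im_x m2) w -> u rx = w.
Proof. by rewrite /= subst_rx => /value_subst. Qed.
Lemma comp_ry w : value (im_y m2) w -> u ry = w.
Proof. by rewrite /= subst_ry => /value_subst. Qed.
Lemma comp_rt w : value (im_t m2) w -> u rt = w.
Proof. by rewrite /= subst_rt => /value_subst. Qed.
Lemma comp_ra0 w : value (im_a0 m2) w -> u ra0 = w.
Proof. by rewrite /= subst_ra0 => /value_subst. Qed.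
Lemma comp_ra1 w : value (im_a1 m2) w -> u ra1 = w.
Proof. by rewrite /= subst_ra1 => /value_subst. Qed.
End CompGenerators.

Lemma eq_on_generators2 (u v : {rmorphism K -> K}) :
  (forall c, u (u (const c)) = v (v (const c))) ->
  u (u rx) = v (v rx) -> u (u ry) = v (v ry) -> u (u rt) = v (v rt) ->
  u (u ra0) = v (v ra0) -> u (u ra1) = v (v ra1) ->
  forall f, u (u f) = v (v f).
Proof. exact: (@eq_on_generators _ _ (u \o u) (v \o v)). Qed.

Lemma s1_s2_braid :
  subst (s1 C) \o subst (s2 C) \o subst (s1 C) \o subst (s2 C) =1
  subst (s2 C) \o subst (s1 C) \o subst (s2 C) \o subst (s1 C).
Proof.
have y0 := ry_neq0 C.
have yt0 : ry - rt != 0 :> K.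
  by rewrite -[ry - rt](subst_ry (s2_inv C)) fmorph_eq0.
(* The two sides are $u^2$ and $v^2$. Once $u$ and $v$ are known on the generators, [value_rmorph]
   yields their squares without composing four substitutions. *)
pose u := subst (s1 C) \o subst (s2 C) : {rmorphism K -> K}.
pose v := subst (s2 C) \o subst (s1 C) : {rmorphism K -> K}.
have uc c : u (const c) = const c by rewrite /= !subst_const.
have vc c : v (const c) = const c by rewrite /= !subst_const.
have ux : u rx = rx + ra1 / ry.
  by apply: comp_rx; rewrite /images /=; prove_value.
have uy : u ry = ry - rt.
  by apply: comp_ry; rewrite /images /=; prove_value.
have ut : u rt = - rt.
  by apply: comp_rt; rewrite /images /=; prove_value.
have u0 : u ra0 = ra0 + ra1.
  by apply: comp_ra0; rewrite /images /=; prove_value.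
have u1 : u ra1 = ra1 + 2 * ra2.
  apply: comp_ra1; apply: value_eq; first by rewrite /images /=; prove_value.
  by rewrite /ra2; abstract_ratfun C; ring.
have vx : v rx = rx + (ra1 + 2 * ra2) / (ry - rt).
  by apply: comp_rx; rewrite /images /=; prove_value.
have vy : v ry = ry - rt.
  by apply: comp_ry; rewrite /images /=; prove_value.
have vt : v rt = - rt.
  by apply: comp_rt; rewrite /images /=; prove_value.
have v0 : v ra0 = ra0 + (ra1 + 2 * ra2).
  by apply: comp_ra0; rewrite /images /=; prove_value.
have v1 : v ra1 = - (ra1 + 2 * ra2).
  by apply: comp_ra1; rewrite /images /=; prove_value.
have ue f w := @value_rmorph _ _ u _ _ _ _ _ _ f w uc ux uy ut u0 u1.
have ve f w := @value_rmorph _ _ v _ _ _ _ _ _ f w vc vx vy vt v0 v1.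
suff uv f : u (u f) = v (v f) by exact: uv.
clearbody u v; move: f; apply: eq_on_generators2 => [c|||||].
- by rewrite !uc !vc.
- rewrite ux vx; transitivity (rx + ra1 / ry + (ra1 + 2 * ra2) / (ry - rt) : K).
    by apply: ue; prove_value.
  symmetry; apply: ve; apply: value_eq.
    (* The morphism $v$ sends $y - t$ to $(y - t) + t$, so this denominator is $y$. *)
    have ytt0 : ry - rt - - rt != 0 :> K by rewrite opprK subrK.
    by prove_value; exact: ytt0.
  rewrite (opprK (rt : K)) subrK addrAC; congr (_ + _ / _ + _).
  by rewrite /ra2; abstract_ratfun C; ring.
- by rewrite uy vy; transitivity (ry : K); [apply: ue|symmetry; apply: ve];
    (apply: value_eq; first prove_value); rewrite opprK subrK.
- by rewrite ut vt; transitivity (rt : K); [apply: ue|symmetry; apply: ve];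
    (apply: value_eq; first prove_value); rewrite opprK.
- rewrite u0 v0; transitivity (ra0 + 2 * (ra1 + ra2) : K); [apply: ue|symmetry; apply: ve];
    (apply: value_eq; first prove_value); by rewrite /ra2; abstract_ratfun C; ring.
- rewrite u1 v1; transitivity (- ra1 : K); [apply: ue|symmetry; apply: ve];
    (apply: value_eq; first prove_value); by rewrite /ra2; abstract_ratfun C; ring.
Qed.
End Relations.

(** Applying the injective [p] to both sides turns [a] into [c] and leaves [b] in place. *)
Lemma braid_conj (T : Type) (p a b c : T -> T) :
  involutive p -> p \o a =1 c \o p -> p \o b =1 b \o p ->
  b \o c \o b \o c =1 c \o b \o c \o b -> a \o b \o a \o b =1 b \o a \o b \o a.
Proof.
move=> pK pa pb bc f; apply: (can_inj pK); move: pa pb bc; rewrite /eqfun /= => pa pb bc.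
by rewrite !(pa, pb) bc.
Qed.

(** Here $(ab)^4 = (baba)(abab)$, which collapses from the middle. *)
Lemma braid_power4 (T : Type) (a b : T -> T) :
  involutive a -> involutive b -> a \o b \o a \o b =1 b \o a \o b \o a ->
  forall f, a (b (a (b (a (b (a (b f))))))) = f.
Proof.
move=> aK bK; rewrite /eqfun /= => ab f.
by rewrite ab !(aK, bK).
Qed.

(** * The defining relations as identities between automorphisms *)

Section WordAction.
Variable C : fieldType.
Local Notation K := (ratfun C).
Local Notation act := (word_act C).

Lemma word_act_cat u v f : act (u ++ v) f = act u (act v f).
Proof. by elim: u => //= i u ->. Qed.

Lemma relator_act r : relator r -> act r =1 id.
Proof.
case=> [[]|||] f.
- exact: (substK (s0_inv C)).
- exact: (substK (s1_inv C)).
- exact: (substK (s2_inv C)).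
- have /= c g := @s0_s2 C g.
  by rewrite /= c (substK (s0_inv C)) (substK (s2_inv C)).
- apply: (@braid_power4 _ (subst (s0 C)) (subst (s1 C)));
    [exact: (substK (s0_inv C)) | exact: (substK (s1_inv C)) |].
  apply: (@braid_conj _ (subst (s_pi C)) (subst (s0 C)) _ (subst (s2 C))).
  + exact: (substK (s_pi_inv C)).
  + exact: s_pi_s0.
  + exact: s_pi_s1.
  + exact: s1_s2_braid.
- apply: (@braid_power4 _ (subst (s1 C)) (subst (s2 C)));
    [exact: (substK (s1_inv C)) | exact: (substK (s2_inv C)) |].
  exact: s1_s2_braid.
Qed.

Lemma weyl_eq_act w1 w2 : weyl_eq w1 w2 -> act w1 =1 act w2.
Proof.
elim=> [w|v w _ IH|u v w _ IH1 _ IH2|u r v rel_r] f //.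
- by rewrite IH1.
- by rewrite !word_act_cat (relator_act rel_r).
Qed.
End WordAction.

(** * Normal forms in the affine Weyl group *)

Lemma weyl_eq_ctx u v w1 w2 : weyl_eq w1 w2 -> weyl_eq (u ++ w1 ++ v) (u ++ w2 ++ v).
Proof.
elim=> [w|w w' _|w w' w'' _ IH1 _ IH2|x r y rel_r]; first exact: weyl_refl.
- exact: weyl_sym.
- exact: weyl_trans IH2.
- rewrite -!catA !(catA u); exact: weyl_rel.
Qed.

#[local] Instance weyl_equiv : RelationClasses.Equivalence weyl_eq.
Proof.
split; [exact: weyl_refl | exact: weyl_sym | exact: weyl_trans].
Qed.

(** Allows rewriting with [weyl_eq] inside concatenations. *)
#[local] Instance cat_weyl :
  Morphisms.Proper
    (Morphisms.respectful weyl_eq (Morphisms.respectful weyl_eq weyl_eq)) cat.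
Proof.
move=> u u' hu v v' hv; apply: (@weyl_trans _ (u' ++ v)).
  exact: (weyl_eq_ctx [::] v hu).
by have := weyl_eq_ctx u' [::] hv; rewrite !cats0.
Qed.

Local Notation "u =W v" := (weyl_eq u v) (at level 70).

Lemma relator_nil r : relator r -> r =W [::].
Proof. by move=> /(weyl_rel [::] [::]); rewrite cats0. Qed.

Lemma cat_rev w : w ++ rev w =W [::].
Proof.
elim: w => [|i w IH]; first exact: weyl_refl.
rewrite rev_cons -cats1 -cat1s -!catA (catA w) IH.
exact: relator_nil (relator_sq i).
Qed.

(** By [cat_rev], reversal is inversion. Cutting a relator in the middle thus gives the commutation
    and braid relations. *)
Lemma relator_rev p q : relator (p ++ q) -> p =W rev q.
Proof.
move=> /relator_nil pq1; rewrite -{1}[p]cats0 -(cat_rev q) catA pq1.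
exact: weyl_refl.
Qed.

(* The pair (b, n) stands for the affine map z |-> z + n or z |-> - z + n. *)
Definition dihedral : Type := bool * int.

Section Dihedral.

(* The words a and b stand for the reflections z |-> 1 - z and z |-> - z, so
   that ba is the translation z |-> z + 1. *)
Section Words.
Variables a b : seq node.

Fixpoint alternating (p q : seq node) n :=
  if n is n'.+1 then p ++ q ++ alternating p q n' else [::].

(** As [Negz n] is $-(n+1)$, it stands for the power [n.+1] of $ab = (ba)^{-1}$. *)
Definition translation (n : int) : seq node :=
  match n with Posz n => alternating b a n | Negz n => alternating a b n.+1 end.

(** The rightmost letters act first: $b$ turns $z$ into $-z$, and the translation by $-n$ then turns
    $-z$ into $-z + n$, whence the sign. *)
Definition dihedral_word (d : dihedral) : seq node :=
  if d.1 then translation d.2 else translation (- d.2) ++ b.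

Hypotheses (aa : a ++ a =W [::]) (bb : b ++ b =W [::]).

Lemma translation_pred n : a ++ b ++ translation n =W translation (n - 1).
Proof.
case: n => [[|n]|n].
- exact: weyl_refl.
- rewrite intS addrAC subrr add0r /= (catA b b) bb /= (catA a a) aa.
  exact: weyl_refl.
- by rewrite (_ : Negz n - 1 = Negz n.+1) ?NegzE -?opprD -?PoszD ?addn1 //; apply: weyl_refl.
Qed.

(** Conjugation by a reflection inverts translations. *)
Lemma translation_opp n : b ++ translation n =W translation (- n) ++ b.
Proof.
have alt p q k : q ++ q =W [::] -> q ++ alternating q p k =W alternating p q k ++ q.
  move=> qq; elim: k => [|k IH] /=; first by rewrite cats0; apply: weyl_refl.
  by rewrite -!catA -IH !(catA q q) qq; apply: weyl_refl.
(* This is an equality of words, only bracketed differently; [alt] needs $q^2 = 1$. *)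
have shift p q k : q ++ alternating p q k = alternating q p k ++ q.
  by elim: k => [|k IH] /=; rewrite ?cats0 // -!catA IH.
case: n => [[|n]|n].
- by rewrite /= cats0; apply: weyl_refl.
- exact: alt.
- by rewrite NegzE opprK -shift; apply: weyl_refl.
Qed.

(** Left multiplication by $a$ substitutes $1 - z$ for $z$ in the affine map, because the leftmost
    letter of a word acts last, on the variable itself. *)
Definition reflect_a (d : dihedral) : dihedral := (~~ d.1, if d.1 then d.2 + 1 else d.2 - 1).
Definition reflect_b (d : dihedral) : dihedral := (~~ d.1, d.2).

Lemma dihedral_word_b d : b ++ dihedral_word d =W dihedral_word (reflect_b d).
Proof.
case: d => [[] n]; rewrite /dihedral_word /=; first exact: translation_opp.
by rewrite catA translation_opp opprK -catA bb cats0; apply: weyl_refl.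
Qed.

(** Write $a = (ab)b$: moving $b$ across a translation inverts it, and $ab$ then lowers the result
    by one. *)
Lemma dihedral_word_a d : a ++ dihedral_word d =W dihedral_word (reflect_a d).
Proof.
have ab n : a ++ translation n =W translation (- (n + 1)) ++ b.
  rewrite opprD -translation_pred -!catA -translation_opp (catA b b) bb.
  exact: weyl_refl.
case: d => [[] n]; rewrite /dihedral_word /=; first exact: ab.
by rewrite catA ab -catA bb cats0 opprD opprK; apply: weyl_refl.
Qed.

End Words.

Lemma dihedral_word_conj x a b a' b' d :
  x ++ a =W a' ++ x -> x ++ b =W b' ++ x ->
  x ++ dihedral_word a b d =W dihedral_word a' b' d ++ x.
Proof.
move=> xa xb.
have alt p q p' q' k : x ++ p =W p' ++ x -> x ++ q =W q' ++ x ->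
    x ++ alternating p q k =W alternating p' q' k ++ x.
  move=> xp xq; elim: k => [|k IH] /=; first by rewrite cats0; apply: weyl_refl.
  by rewrite catA xp -catA (catA x) xq -!catA IH; apply: weyl_refl.
have tr n : x ++ translation a b n =W translation a' b' n ++ x.
  by case: n => n; apply: alt.
case: d => [[] n]; rewrite /dihedral_word /=; first exact: tr.
by rewrite catA tr -!catA xb; apply: weyl_refl.
Qed.

End Dihedral.

Definition normal_word (g : dihedral * dihedral * bool) : seq node :=
  dihedral_word [:: n0] [:: n1; n2; n1] g.1.1 ++
  dihedral_word [:: n1; n0; n1] [:: n2] g.1.2 ++ (if g.2 then [:: n1] else [::]).

(* Left multiplication by a generator, in terms of normal forms. *)
Definition simple_step (i : node) (g : dihedral * dihedral * bool) :=
  let: (d1, d2, e) := g in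
  match i with
  | n0 => (reflect_a d1, d2, e)
  | n1 => (d2, d1, ~~ e)
  | n2 => (d1, reflect_b d2, e)
  end.

Lemma sq_nil i : [:: i; i] =W [::].
Proof. exact: relator_nil (relator_sq i). Qed.

Lemma cancel_sq i w : [:: i, i & w] =W w.
Proof. by rewrite -[X in X =W _]/([:: i; i] ++ w) sq_nil; apply: weyl_refl. Qed.

Lemma commute_02 : [:: n0; n2] =W [:: n2; n0].
Proof. exact: (@relator_rev [:: n0; n2] _ relator_02). Qed.

Lemma braid_01 : [:: n0; n1; n0; n1] =W [:: n1; n0; n1; n0].
Proof. exact: (@relator_rev [:: n0; n1; n0; n1] _ relator_01). Qed.

Lemma braid_12 : [:: n1; n2; n1; n2] =W [:: n2; n1; n2; n1].
Proof. exact: (@relator_rev [:: n1; n2; n1; n2] _ relator_12). Qed.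

Lemma commute_cat x a b d :
  x ++ a =W a ++ x -> x ++ b =W b ++ x ->
  dihedral_word a b d ++ x =W x ++ dihedral_word a b d.
Proof. by move=> xa xb; apply: weyl_sym; apply: dihedral_word_conj. Qed.

Lemma cancel_ctx u i w : u ++ [:: i, i & w] =W u ++ w.
Proof. by rewrite cancel_sq; apply: weyl_refl. Qed.

(** Conjugation by [n1] exchanges the generating pairs of the two dihedral groups, and each
    generator of one group commutes with each generator of the other, as [ad], [ca], [cb] and [bd]
    state. *)
Lemma normal_word_step i g : i :: normal_word g =W normal_word (simple_step i g).
Proof.
have bb : [:: n1; n2; n1] ++ [:: n1; n2; n1] =W [::].
  exact: cat_rev [:: n1; n2; n1].
have dd : [:: n1; n0; n1] ++ [:: n1; n0; n1] =W [::].
  exact: cat_rev [:: n1; n0; n1].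
have ad : [:: n0] ++ [:: n1; n0; n1] =W [:: n1; n0; n1] ++ [:: n0] := braid_01.
have ca : [:: n2] ++ [:: n0] =W [:: n0] ++ [:: n2] := weyl_sym commute_02.
have cb : [:: n2] ++ [:: n1; n2; n1] =W [:: n1; n2; n1] ++ [:: n2] := weyl_sym braid_12.
(* Both sides reduce to the conjugate by [n1] of a product of [n0] and [n2], which commute. *)
have bd : [:: n1; n2; n1] ++ [:: n1; n0; n1] =W [:: n1; n0; n1] ++ [:: n1; n2; n1].
  apply: weyl_trans (cancel_ctx [:: n1; n2] n1 [:: n0; n1]) _.
  apply: weyl_trans _ (weyl_sym (cancel_ctx [:: n1; n0] n1 [:: n2; n1])).
  exact: (weyl_eq_ctx [:: n1] [:: n1] (weyl_sym commute_02)).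
have s1a : [:: n1] ++ [:: n0] =W [:: n1; n0; n1] ++ [:: n1].
  exact: weyl_sym (cancel_ctx [:: n1; n0] n1 [::]).
have s1b : [:: n1] ++ [:: n1; n2; n1] =W [:: n2] ++ [:: n1] by exact: cancel_sq.
have s1d : [:: n1] ++ [:: n1; n0; n1] =W [:: n0] ++ [:: n1] by exact: cancel_sq.
have s1c : [:: n1] ++ [:: n2] =W [:: n1; n2; n1] ++ [:: n1].
  exact: weyl_sym (cancel_ctx [:: n1; n2] n1 [::]).
case: g => [[d1 d2] e]; rewrite -cat1s /normal_word; case: i => /=.
- rewrite -cat1s catA dihedral_word_a //; first exact: weyl_refl.
  exact: sq_nil.
(* Moving [n1] to the right sends each factor into the other group; commuting the two factors
   restores the order of the normal form. *)
- rewrite -cat1s catA (dihedral_word_conj _ s1a s1b) -catA.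
  rewrite (catA [:: n1]) (dihedral_word_conj _ s1d s1c) -catA catA.
  rewrite (commute_cat (x := dihedral_word [:: n0] [:: n1; n2; n1] d2)).
  + by rewrite -catA; case: e; rewrite /= ?sq_nil ?cats0; apply: weyl_refl.
  + exact: commute_cat _ (weyl_sym ad) (weyl_sym bd).
  + exact: commute_cat _ ca cb.
- rewrite -cat1s catA -(commute_cat d1 ca cb) -catA.
  rewrite (catA [:: n2]) dihedral_word_b //; first exact: weyl_refl.
  exact: sq_nil.
Qed.

Definition normal_form (w : seq node) :=
  foldr simple_step ((true, 0), (true, 0), false) w.

Lemma normal_formP w : w =W normal_word (normal_form w).
Proof.
elim: w => [|i w IH]; first exact: weyl_refl.
rewrite /= -normal_word_step -cat1s -[X in _ =W X]cat1s -IH; exact: weyl_refl.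
Qed.

(** * Faithfulness, from the action on the parameters *)

Definition dihedral_act (R : nzRingType) (d : dihedral) (z : R) : R :=
  (if d.1 then z else - z) + d.2%:~R.

Lemma dihedral_act_reflect_a (R : nzRingType) d (z : R) :
  dihedral_act (reflect_a d) z = dihedral_act d (1 - z).
Proof.
case: d => [[] n]; rewrite /dihedral_act /= ?rmorphD ?rmorphN ?rmorph1 /=.
  by rewrite [n%:~R + 1]addrC addrA [- z + 1]addrC.
by rewrite opprB addrA addrAC.
Qed.

Lemma dihedral_act_reflect_b (R : nzRingType) d (z : R) :
  dihedral_act (reflect_b d) z = dihedral_act d (- z).
Proof. by case: d => [[] n]; rewrite /dihedral_act /= ?opprK. Qed.

Lemma rmorph_dihedral_act (R S : nzRingType) (u : {rmorphism R -> S}) d z :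
  u (dihedral_act d z) = dihedral_act d (u z).
Proof. by case: d => [[] n]; rewrite /dihedral_act rmorphD ?rmorphN rmorph_int. Qed.

Section Faithful.
Variable C : numFieldType.
Local Notation K := (ratfun C).

Definition eps1 : K := ra1 + ra2.
Definition eps2 : K := ra2.

Let half_neq0 : 2 * 2^-1 = 1 :> K.
Proof.
have -> : 2 = const 2 :> K by rewrite rmorph_nat.
by rewrite -fmorphV -rmorphM /= divff ?pnatr_eq0 // rmorph1.
Qed.

Lemma s0_eps1 : subst (s0 C) eps1 = 1 - eps1.
Proof.
apply: (@value_subst _ (s0_inv C)); apply: value_eq.
  by rewrite /eps1 /images /=; prove_value.
(* The image $\alpha_1 + 2\alpha_0 + \alpha_2$ is twice the sum of the parameters minus [eps1];
   characteristic zero makes twice one half equal to $1$. *)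
transitivity (2 * 2^-1 - eps1); last by rewrite half_neq0.
by rewrite /eps1 /ra2; abstract_ratfun C; ring.
Qed.

Lemma s0_eps2 : subst (s0 C) eps2 = eps2.
Proof.
apply: (@value_subst _ (s0_inv C)); apply: value_eq.
  by rewrite /eps2 /images /=; prove_value.
by rewrite /eps2 /ra2; abstract_ratfun C; ring.
Qed.

Lemma s1_eps1 : subst (s1 C) eps1 = eps2.
Proof.
apply: (@value_subst _ (s1_inv C)); apply: value_eq.
  by rewrite /eps1 /images /=; prove_value.
by rewrite /eps2 /ra2; abstract_ratfun C; ring.
Qed.

Lemma s1_eps2 : subst (s1 C) eps2 = eps1.
Proof. by rewrite -s1_eps1 (substK (s1_inv C)). Qed.

Lemma s2_eps1 : subst (s2 C) eps1 = eps1.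
Proof.
apply: (@value_subst _ (s2_inv C)); apply: value_eq.
  by rewrite /eps1 /images /=; prove_value.
by rewrite /eps1 /ra2; abstract_ratfun C; ring.
Qed.

Lemma s2_eps2 : subst (s2 C) eps2 = - eps2.
Proof.
apply: (@value_subst _ (s2_inv C)); apply: value_eq.
  by rewrite /eps2 /images /=; prove_value.
by rewrite /eps2 /ra2; abstract_ratfun C; ring.
Qed.

(** A substitution commutes with [dihedral_act d] and so reaches the innermost [eps1] or [eps2];
    reflecting or exchanging these is the rule of [simple_step]. *)
Lemma word_act_eps w :
  let: (d1, d2, e) := normal_form w in
  word_act C w eps1 = (if e then dihedral_act d2 eps2 else dihedral_act d1 eps1) /\
  word_act C w eps2 = (if e then dihedral_act d1 eps1 else dihedral_act d2 eps2).
Proof.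
elim: w => [|i w] /=; first by rewrite /dihedral_act /= !addr0.
have act0 d (f : K) : subst (s0 C) (dihedral_act d f) = dihedral_act d (subst (s0 C) f)
  := rmorph_dihedral_act (subst (s0 C)) d f.
have act1 d (f : K) : subst (s1 C) (dihedral_act d f) = dihedral_act d (subst (s1 C) f)
  := rmorph_dihedral_act (subst (s1 C)) d f.
have act2 d (f : K) : subst (s2 C) (dihedral_act d f) = dihedral_act d (subst (s2 C) f)
  := rmorph_dihedral_act (subst (s2 C)) d f.
by case: (normal_form w) => [[d1 d2] e] [-> ->]; case: i => /=; case: e; split;
  rewrite ?act0 ?act1 ?act2 ?dihedral_act_reflect_a ?dihedral_act_reflect_b
    ?s0_eps1 ?s0_eps2 ?s1_eps1 ?s1_eps2 ?s2_eps1 ?s2_eps2.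
Qed.

Lemma value_dihedral_act (p : 'I_5 -> C) d f v :
  value (idfun : {rmorphism C -> C}) p f v ->
  value (idfun : {rmorphism C -> C}) p (dihedral_act d f) (dihedral_act d v).
Proof.
move=> h; case: d => [s n]; rewrite /dihedral_act /=; apply: valueD.
  by case: s => //; apply: valueN.
rewrite -(rmorph_int (@const C)); exact: value_const.
Qed.

Lemma eps_value (v1 v2 : C) : exists p : 'I_5 -> C,
  value (idfun : {rmorphism C -> C}) p eps1 v1 /\
  value (idfun : {rmorphism C -> C}) p eps2 v2.
Proof.
(* The parameters solve $\alpha_1 + \alpha_2 = v_1$ and $\alpha_2 = v_2$; the zeros are arbitrary
   values of $x, y, t$. *)
exists (valuation 0 0 0 (2^-1 - v1) (v1 - v2)); rewrite /eps1 /eps2.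
by split; (apply: value_eq; first prove_value); ring.
Qed.

(** The image of $0$ gives the translation part; the image of $1$ then gives the sign, as $1 \neq
    -1$. *)
Lemma dihedral_act_inj d d' :
  dihedral_act d (0 : C) = dihedral_act d' 0 ->
  dihedral_act d (1 : C) = dihedral_act d' 1 -> d = d'.
Proof.
case: d d' => [s n] [s' n']; rewrite /dihedral_act /= !oppr0 !if_same !add0r.
move=> /(mulrIz (oner_neq0 _)) -> /addIr.
have n1 : 1 != -1 :> C.
  by rewrite -subr_eq0 opprK -(natrD _ 1 1) pnatr_eq0.
by case: s s' => [] [] // /eqP; rewrite ?(negPf n1) // eq_sym (negPf n1).
Qed.

(** For use with [eps1] moving from $0$ to $1$ while [eps2] stays at $0$: only the left side of an
    equality would change. *)
Lemma dihedral_act_neq d d' :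
  dihedral_act d (0 : C) = dihedral_act d' 0 ->
  dihedral_act d (1 : C) <> dihedral_act d' 0.
Proof.
case: d d' => [s n] [s' n']; rewrite /dihedral_act /= !oppr0 !if_same !add0r.
move=> <- /eqP; rewrite -subr_eq0 addrK; apply/negP.
by case: s; rewrite ?oppr_eq0 oner_neq0.
Qed.

Lemma dihedral_act_eval d d' f f' (v v' : C) p :
  value (idfun : {rmorphism C -> C}) p f v ->
  value (idfun : {rmorphism C -> C}) p f' v' ->
  dihedral_act d f = dihedral_act d' f' -> dihedral_act d v = dihedral_act d' v'.
Proof.
move=> /(value_dihedral_act d) hv /(value_dihedral_act d') hv' e.
by rewrite e in hv; apply: value_fun hv hv'.
Qed.

Lemma dihedral_eps1_inj d d' : dihedral_act d eps1 = dihedral_act d' eps1 -> d = d'.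
Proof.
move=> e; have [p [hp _]] := eps_value 0 0; have [q [hq _]] := eps_value 1 0.
apply: dihedral_act_inj.
- exact: (dihedral_act_eval hp hp e).
- exact: (dihedral_act_eval hq hq e).
Qed.

Lemma dihedral_eps2_inj d d' : dihedral_act d eps2 = dihedral_act d' eps2 -> d = d'.
Proof.
move=> e; have [p [_ hp]] := eps_value 0 0; have [q [_ hq]] := eps_value 0 1.
apply: dihedral_act_inj.
- exact: (dihedral_act_eval hp hp e).
- exact: (dihedral_act_eval hq hq e).
Qed.

Lemma dihedral_eps_neq d d' : dihedral_act d eps1 <> dihedral_act d' eps2.
Proof.
move=> e; have [p [hp hp']] := eps_value 0 0; have [q [hq hq']] := eps_value 1 0.
apply: (@dihedral_act_neq d d').
- exact: (dihedral_act_eval hp hp' e).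
- exact: (dihedral_act_eval hq hq' e).
Qed.

Lemma word_act_faithful w1 w2 : word_act C w1 =1 word_act C w2 -> w1 =W w2.
Proof.
move=> h; rewrite (normal_formP w1) (normal_formP w2).
suff -> : normal_form w1 = normal_form w2 by apply: weyl_refl.
have := word_act_eps w1; have := word_act_eps w2; rewrite !h.
case: (normal_form w1) => [[d1 d2] e]; case: (normal_form w2) => [[d1' d2'] e'].
case=> -> -> [].
(* When the exponents of [n1] differ, an affine function of [eps1] would equal one of [eps2]. *)
case: e; case: e'.
- by move=> /dihedral_eps2_inj -> /dihedral_eps1_inj ->.
- by move=> /dihedral_eps_neq.
- by move=> /esym /dihedral_eps_neq.
- by move=> /dihedral_eps1_inj -> /dihedral_eps2_inj ->.
Qed.

End Faithful.

(** * Transformation of solutions *)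

Section Derivatives.
Variable C : numFieldType.
Implicit Types (f g : C -> C) (s : C).

Lemma is_derive_add f g s df dg : is_derive s 1 f df -> is_derive s 1 g dg ->
  is_derive s 1 (fun u => f u + g u) (df + dg).
Proof. by move=> hf hg; apply: is_deriveD. Qed.

Lemma is_derive_opp f s df : is_derive s 1 f df ->
  is_derive s 1 (fun u => - f u) (- df).
Proof. by move=> hf; apply: is_deriveN. Qed.

Lemma is_derive_mul f g s df dg : is_derive s 1 f df -> is_derive s 1 g dg ->
  is_derive s 1 (fun u => f u * g u) (f s * dg + g s * df).
Proof. by move=> hf hg; apply: is_deriveM. Qed.

Lemma is_derive_scale (k : C) f s df : is_derive s 1 f df ->
  is_derive s 1 (fun u => k * f u) (k * df).
Proof. by move=> hf; apply: is_deriveZ. Qed.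

Lemma is_derive_sqr f s df : is_derive s 1 f df ->
  is_derive s 1 (fun u => f u ^+ 2) (2 * f s * df).
Proof. by move=> hf; apply: (is_deriveX 2). Qed.

Lemma is_derive_div (k : C) f s df : f s != 0 -> is_derive s 1 f df ->
  is_derive s 1 (fun u => k / f u) (- (k * df / f s ^+ 2)).
Proof.
move=> fs0 [hf <-]; apply: is_derive_eq.
  by apply: is_derive_scale; split; [exact: derivableV | exact: deriveV].
by rewrite [in LHS]/GRing.scale /= mulNr mulrN mulrA mulrAC.
Qed.

(** The chain rule for $t' = -t$, as in $s_0$ and $s_2$; the differential of negation sends $1$ to
    $-1$. *)
Lemma is_derive_reflect f s df : is_derive (- s) 1 f df ->
  is_derive s 1 (fun u => f (- u)) (- df).
Proof.
move=> [/derivable1_diffP hf <-].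
have hN : differentiable (-%R : C -> C) s by exact: differentiableN.
have hc : differentiable (f \o -%R) s by exact: differentiable_comp.
split; first exact/derivable1_diffP.
have dN : 'd (-%R : C -> C) s 1 = -1.
  by rewrite -(deriveE _ hN); have [_] := is_deriveNid s (1 : C).
rewrite (deriveE _ hc) (diff_comp hN hf) (deriveE _ hf).
by apply: etrans (congr1 ('d f (- s)) dN) _; rewrite linearN.
Qed.

(** Needed because the hypotheses determine [xi] and [eta] on [V] only. *)
Lemma is_derive_open (V : set C) f g s df : open V -> V s ->
  (forall u, V u -> f u = g u) -> is_derive s 1 f df -> is_derive s 1 g df.
Proof.
move=> oV Vs fg; apply: near_eq_is_derive.
by apply: filterS (open_nbhs_nbhs (conj oV Vs)) => u /fg.
Qed.

End Derivatives.

(** * The Baecklund property of the four transformations *)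

Section Backlund.
Variable C : numClosedFieldType.
Local Notation K := (ratfun C).
Implicit Types (p : 'I_5 -> C).

Lemma has_value_fun (f : K) p v w :
  has_value f p v -> value (idfun : {rmorphism C -> C}) p f w -> v = w.
Proof. exact: value_fun. Qed.

(** Multiplying by $x^2$ gives a polynomial identity between values, which at $x = 0$ would read $0
    = -1$. *)
Lemma has_value_s0_y x y t a0 a1 v : has_value (im_y (s0 C)) (valuation x y t a0 a1) v ->
  x != 0 /\ v = - y + 2 * a0 / x - 1 / x ^+ 2.
Proof.
move=> hv.
have : v * x ^+ 2 = - y * x ^+ 2 + 2 * a0 * x - 1.
  have hvx := valueM (hv : value idfun _ _ _) (valueX 2 (value_rx _ _ _ _ _ _)).
  apply: (value_fun hvx).
  have -> : im_y (s0 C) * rx ^+ 2 = - ry * rx ^+ 2 + 2 * ra0 * rx - 1.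
    rewrite -[im_y _]/(- ry + 2 * ra0 / rx - 1 / rx ^+ 2 : K).
    by move: (rx_neq0 C); abstract_ratfun C => x0; field.
  by prove_value.
have [->|x0] := eqVneq x 0 => e.
  by move: e; rewrite expr0n !mulr0 !add0r => /eqP; rewrite eq_sym oppr_eq0 oner_eq0.
by split=> //; apply: (mulIf (expf_neq0 2 x0)); rewrite e; field.
Qed.

(** Multiplying by $tx$ gives $v\,tx = 1$, which excludes $x = 0$. *)
Lemma has_value_pi_x x y t a0 a1 v : has_value (im_x (s_pi C)) (valuation x y t a0 a1) v ->
  x != 0 /\ v = 1 / (t * x).
Proof.
move=> hv.
have e : v * (t * x) = 1.
  have hvx := valueM (hv : value idfun _ _ _)
    (valueM (value_rt _ _ _ _ _ _) (value_rx _ _ _ _ _ _)).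
  apply: (value_fun hvx).
  rewrite /= mul1r mulVf; first exact: value1.
  by apply: mulf_neq0; [exact: rt_neq0 | exact: rx_neq0].
have tx0 : t * x != 0.
  by apply: contra_eq_neq e => ->; rewrite mulr0 eq_sym oner_eq0.
split; first by move: tx0; rewrite mulf_eq0 negb_or => /andP [].
by apply: (mulIf tx0); rewrite e mul1r mulVf.
Qed.

(* If y = 0, then x + a1/y having a value forces a1 = 0, which is no
   contradiction yet. But a representation n/d of x + alpha1/y satisfies
   n y = d (x y + alpha1), and letting alpha1 vary on y = 0 shows that d
   vanishes there. *)
Lemma has_value_s1_x x y t a0 a1 v : has_value (im_x (s1 C)) (valuation x y t a0 a1) v ->
  y != 0 /\ v = x + a1 / y.
Proof.
move=> hv.
have e : v * y = x * y + a1.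
  have hvx := valueM (hv : value idfun _ _ _) (value_ry _ _ _ _ _ _).
  apply: (value_fun hvx).
  have -> : im_x (s1 C) * ry = rx * ry + ra1.
    rewrite -[im_x _]/(rx + ra1 / ry : K).
    by move: (ry_neq0 C); abstract_ratfun C => y0; field.
  by prove_value.
have [y0|y0] := eqVneq y 0; last first.
  by split=> //; apply: (mulIf y0); rewrite e; field.
case: hv => n [d [end_ d0 _]]; have ed0 := mmap_neq0_embed d0.
case/negP: d0; rewrite y0.
have nd : n * mpolyX C (mnm1 (@Ordinal 5 1 isT)) =
    d * (mpolyX C (mnm1 (@Ordinal 5 0 isT)) * mpolyX C (mnm1 (@Ordinal 5 1 isT))
         + mpolyX C (mnm1 (@Ordinal 5 4 isT))).
  apply: embed_inj; rewrite [LHS]rmorphM [RHS]rmorphM rmorphD rmorphM.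
  change (embed n * ry = embed d * (rx * ry + ra1) :> K).
  have -> : embed n = (rx + ra1 / ry) * embed d :> K by rewrite [_ + _]end_ mulfVK.
  by move: (ry_neq0 C) (embed d); abstract_ratfun C => y0' D; field.
(* Here $y = 0$ and $\alpha_1$ is the indeterminate of $C[X]$: [nd] says that the image of [d] times
   $X$ vanishes, so this image is zero, and so is its value at [a1]. *)
pose h : 'I_5 -> {poly C} := valuation x%:P 0 t%:P a0%:P 'X.
have dX : mmap (@polyC C) h d * 'X = 0.
  have := congr1 (mmap (@polyC C) h) nd.
  rewrite !rmorphM rmorphD rmorphM /= !mmapX !mmap1U /h /valuation /=.
  by rewrite !mulr0 add0r => <-.
have d0 : mmap (@polyC C) h d = 0 by move/eqP: dX; rewrite mulf_eq0 polyX_eq0 orbF => /eqP.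
have <- : (mmap (@polyC C) h d).[a1] = meval (valuation x 0 t a0 a1) d.
  rewrite -[LHS]/(horner_eval a1 _) rmorph_sum; apply: eq_bigr => m _.
  rewrite rmorphM /= [horner_eval _ _%:P]hornerC rmorph_prod; congr (_ * _); apply: eq_bigr => i _.
  rewrite rmorphXn; congr (_ ^+ _); move: i; apply: forall_ord5;
    by rewrite /h /valuation /= /horner_eval ?hornerC ?hornerX ?horner0.
by rewrite d0 horner0.
Qed.

Lemma s0_backlund : is_backlund (s0 C).
Proof.
move=> a0 a1 a2 U x y [sum_a oU sol] b0 b1 b2 V tau xi eta [s' Vs'] oV _ VU H.
have tauE s : V s -> tau s = - s.
  move=> Vs; have [[_ _ /has_value_fun ht] _] := H s Vs.
  by apply: oppr_inj; rewrite opprK; apply/esym/ht => /=; prove_value.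
have xiE s : V s -> - x (- s) = xi s.
  move=> Vs; have [[/has_value_fun hx _ _] _] := H s Vs; rewrite -(tauE s Vs).
  by apply/esym/hx => /=; prove_value.
have etaE s : V s -> x (- s) != 0 /\ - y (- s) + 2 * a0 / x (- s) - 1 / x (- s) ^+ 2 = eta s.
  by move=> Vs; have [[_ /has_value_s0_y [x0 ->] _] _] := H s Vs; rewrite -(tauE s Vs).
(* The new parameters are given through values at points of [V], so a point [s'] is used to identify
   them. *)
have [_ [/has_value_fun h0 /has_value_fun h1 /has_value_fun h2]] := H s' Vs'.
have -> : b0 = - a0 by apply: h0 => /=; prove_value.
have -> : b2 = a2.
  by transitivity (2^-1 - a0 - a1); [apply: h2 => /=; prove_value | rewrite -sum_a; ring].
have -> : b1 = a1 + 2 * a0 by apply: h1 => /=; prove_value.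
split=> // [|s Vs]; first by rewrite -sum_a; ring.
have [x0 _] := etaE s Vs.
have := VU s Vs; rewrite tauE // => /sol [].
rewrite oppr_eq0 => s0 /is_derive_reflect dx /is_derive_reflect dy.
split=> //.
- apply: (is_derive_open oV Vs xiE); apply: (is_derive_eq (is_derive_opp dx)).
  by rewrite -xiE // -(proj2 (etaE s Vs)); field; rewrite ?oppr_eq0 s0 x0.
- apply: (is_derive_open oV Vs (fun u Vu => proj2 (etaE u Vu))).
  have d1 := is_derive_div (2 * a0) x0 dx.
  have d2 := is_derive_div 1 (f := fun u => x (- u) ^+ 2) (expf_neq0 2 x0) (is_derive_sqr dx).
  apply: (is_derive_eq (is_derive_add (is_derive_add (is_derive_opp dy) d1) (is_derive_opp d2))).
  rewrite -xiE // -(proj2 (etaE s Vs)) /GRing.scale /=.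
  by field; rewrite ?oppr_eq0 s0 x0.
Qed.

Lemma s1_backlund : is_backlund (s1 C).
Proof.
move=> a0 a1 a2 U x y [sum_a oU sol] b0 b1 b2 V tau xi eta [s' Vs'] oV _ VU H.
have tauE s : V s -> tau s = s.
  move=> Vs; have [[_ _ /has_value_fun ht] _] := H s Vs.
  by apply/esym/ht => /=; prove_value.
have xiE s : V s -> y s != 0 /\ x s + a1 / y s = xi s.
  move=> Vs; have [[/has_value_s1_x [] + + _ _] _] := H s Vs.
  by rewrite tauE // => y0 ->.
have etaE s : V s -> y s = eta s.
  move=> Vs; have [[_ /has_value_fun hy _] _] := H s Vs; rewrite -[in LHS](tauE s Vs).
  by apply/esym/hy => /=; prove_value.
have [_ [/has_value_fun h0 /has_value_fun h1 /has_value_fun h2]] := H s' Vs'.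
have -> : b0 = a0 + a1 by apply: h0 => /=; prove_value.
have -> : b1 = - a1 by apply: h1 => /=; prove_value.
have -> : b2 = a2 + a1.
  transitivity (2^-1 - a0 - a1 + a1); last by rewrite -sum_a; ring.
  by apply: h2 => /=; prove_value.
split=> // [|s Vs]; first by rewrite -sum_a; ring.
have [y0 _] := xiE s Vs.
have := VU s Vs; rewrite tauE // => /sol [s0 dx dy].
split=> //.
- apply: (is_derive_open oV Vs (fun u Vu => proj2 (xiE u Vu))).
  apply: (is_derive_eq (is_derive_add dx (is_derive_div a1 y0 dy))).
  by rewrite -(proj2 (xiE s Vs)) -etaE //; field; rewrite s0 y0.
- apply: (is_derive_open oV Vs etaE); apply: (is_derive_eq dy).
  by rewrite -(proj2 (xiE s Vs)) -etaE //; field; rewrite s0 y0.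
Qed.

Lemma s2_backlund : is_backlund (s2 C).
Proof.
move=> a0 a1 a2 U x y [sum_a oU sol] b0 b1 b2 V tau xi eta [s' Vs'] oV _ VU H.
have tauE s : V s -> tau s = - s.
  move=> Vs; have [[_ _ /has_value_fun ht] _] := H s Vs.
  by apply: oppr_inj; rewrite opprK; apply/esym/ht => /=; prove_value.
have xiE s : V s -> x (- s) = xi s.
  move=> Vs; have [[/has_value_fun hx _ _] _] := H s Vs; rewrite -(tauE s Vs).
  by apply/esym/hx => /=; prove_value.
have etaE s : V s -> y (- s) + s = eta s.
  move=> Vs; have [[_ /has_value_fun hy _] _] := H s Vs.
  rewrite -[X in _ + X]opprK -(tauE s Vs).
  by apply/esym/hy => /=; prove_value.
have [_ [/has_value_fun h0 /has_value_fun h1 /has_value_fun h2]] := H s' Vs'.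
have a2E : 2^-1 - a0 - a1 = a2 by rewrite -sum_a; ring.
have -> : b0 = a0 by apply: h0 => /=; prove_value.
have -> : b1 = a1 + 2 * a2 by rewrite -a2E; apply: h1 => /=; prove_value.
have -> : b2 = - a2 by rewrite -a2E; apply: h2 => /=; prove_value.
split=> // [|s Vs]; first by rewrite -sum_a; ring.
have := VU s Vs; rewrite tauE // => /sol [].
rewrite oppr_eq0 => s0 /is_derive_reflect dx /is_derive_reflect dy.
split=> //.
- apply: (is_derive_open oV Vs xiE); apply: (is_derive_eq dx).
  by rewrite -xiE // -etaE //; field; rewrite ?oppr_eq0 s0.
- apply: (is_derive_open oV Vs etaE).
  apply: (is_derive_eq (is_derive_add dy (is_derive_id s 1))).
  (* The identity holds modulo the linear relation only: the derivative $1$ of the added $s$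
     balances $2(\alpha_0 + \alpha_1 + \alpha_2)$. *)
  have -> : a2 = 2^-1 - a0 - a1 by rewrite a2E.
  by rewrite -xiE // -etaE //; field; rewrite ?oppr_eq0 s0 ?pnatr_eq0.
Qed.

Lemma s_pi_backlund : is_backlund (s_pi C).
Proof.
move=> a0 a1 a2 U x y [sum_a oU sol] b0 b1 b2 V tau xi eta [s' Vs'] oV _ VU H.
have tauE s : V s -> tau s = s.
  move=> Vs; have [[_ _ /has_value_fun ht] _] := H s Vs.
  by apply/esym/ht => /=; prove_value.
have xiE s : V s -> x s != 0 /\ 1 / (s * x s) = xi s.
  move=> Vs; have [[/has_value_pi_x [] + + _ _] _] := H s Vs.
  by rewrite tauE // => x0 ->.
have etaE s : V s -> - s * x s * (y s * x s + a1) = eta s.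
  move=> Vs; have [[_ /has_value_fun hy _] _] := H s Vs.
  by apply/esym/hy => /=; rewrite tauE //; prove_value.
have [_ [/has_value_fun h0 /has_value_fun h1 /has_value_fun h2]] := H s' Vs'.
have a2E : 2^-1 - a0 - a1 = a2 by rewrite -sum_a; ring.
have -> : b0 = a2 by rewrite -a2E; apply: h0 => /=; prove_value.
have -> : b1 = a1 by apply: h1 => /=; prove_value.
have -> : b2 = a0 by apply: h2 => /=; prove_value.
split=> // [|s Vs]; first by rewrite -sum_a; ring.
have [x0 _] := xiE s Vs.
have := VU s Vs; rewrite tauE // => /sol [s0 dx dy].
have dtx : is_derive s 1 (fun u => u * x u) _ := is_derive_mul (is_derive_id s 1) dx.
have tx0 : s * x s != 0 by rewrite mulf_neq0.
split=> //.
- apply: (is_derive_open oV Vs (fun u Vu => proj2 (xiE u Vu))).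
  apply: (is_derive_eq (is_derive_div 1 (f := fun u => u * x u) tx0 dtx)).
  (* Differentiating the factor $t$ of $tx$ gives a term that cancels only through $2(\alpha_0 +
     \alpha_1 + \alpha_2) = 1$, so [a2] is eliminated first. *)
  rewrite -(proj2 (xiE s Vs)) -etaE // -a2E.
  by field; rewrite ?oppr_eq0 s0 x0 ?pnatr_eq0.
- apply: (is_derive_open oV Vs etaE).
  have dN : is_derive s 1 (fun u : C => - u) _ := is_derive_opp (is_derive_id s 1).
  have d1 := is_derive_mul dN dx.
  have d2 : is_derive s 1 (fun u => y u * x u + a1) _ :=
    is_derive_add (is_derive_mul dy dx) (is_derive_cst a1 s 1).
  apply: (is_derive_eq (is_derive_mul d1 d2)).
  rewrite -(proj2 (xiE s Vs)) -etaE // -a2E /=.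
  by field; rewrite ?oppr_eq0 s0 x0 ?pnatr_eq0.
Qed.
End Backlund.

Theorem theorem3p1 (R : realType) :
  let C : numClosedFieldType := complex R in
  [/\ [/\ is_automorphism (s0 C), is_automorphism (s1 C),
          is_automorphism (s2 C) & is_automorphism (s_pi C)],
      [/\ is_backlund (s0 C), is_backlund (s1 C),
          is_backlund (s2 C) & is_backlund (s_pi C)],
      (forall w1 w2 : seq node,
         word_act C w1 =1 word_act C w2 <-> weyl_eq w1 w2) &
      [/\ subst (s_pi C) \o subst (s_pi C) =1 id,
          subst (s_pi C) \o subst (s0 C) =1 subst (s2 C) \o subst (s_pi C) &
          subst (s_pi C) \o subst (s1 C) =1 subst (s1 C) \o subst (s_pi C)]].
Proof.
move=> C; split.
- split.
  + apply: (@involution_is_automorphism _ (s0_inv C)).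
    by rewrite [LHS]/= /ra2; abstract_ratfun C; ring.
  + apply: (@involution_is_automorphism _ (s1_inv C)).
    by rewrite [LHS]/= /ra2; abstract_ratfun C; ring.
  + apply: (@involution_is_automorphism _ (s2_inv C)).
    by rewrite [LHS]/= /ra2; abstract_ratfun C; ring.
  + apply: (@involution_is_automorphism _ (s_pi_inv C)).
    by rewrite [LHS]/= /ra2; abstract_ratfun C; ring.
- split; [exact: s0_backlund | exact: s1_backlund | exact: s2_backlund |
    exact: s_pi_backlund].
- by move=> w1 w2; split; [exact: word_act_faithful | exact: weyl_eq_act].
- split; [exact: (substK (s_pi_inv C)) | exact: s_pi_s0 | exact: s_pi_s1].
Qed.
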